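(* Let $S^{(1)},S^{(2)}\in\operatorname{Sp}(2n,\mathbb{R})$ with block forms $S^{(p)}=\begin{pmatrix}A^{(p)}&B^{(p)}\\ C^{(p)}&D^{(p)}\end{pmatrix}$, $p=1,2$, let $D^{(1,2)}=\begin{pmatrix}A^{(1)}&B^{(1)}\\ A^{(2)}&B^{(2)}\end{pmatrix}$, assume $\det D^{(1,2)}\neq0$, and let $\Omega=D^{(1,2)}J(D^{(1,2)})^T$ and $\vartheta(z,z')=z\cdot\Omega^{-1}z'$. Then the uncertainty principle $$\Upsilon+\frac{i}{4\pi}\Omega\ge0$$ is invariant under every linear transformation $\gamma\mapsto P\gamma$ with $P\in\operatorname{Sp}(2n,\vartheta)$. That is, if $P\in\operatorname{Sp}(2n,\vartheta)$ and $\Upsilon$ is a real symmetric $2n\times2n$ matrix (a covariance matrix of the variables $\gamma\in\mathbb{R}^{2n}$, which transforms as $\Upsilon\mapsto P\Upsilon P^T$ under $\gamma\mapsto P\gamma$) satisfying $\Upsilon+\frac{i}{4\pi}\Omega\ge0$, then $$P\Upsilon P^T+\frac{i}{4\pi}\Omega\ge0 .$$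
   Context: $J=\begin{pmatrix}0&I_n\\ -I_n&0\end{pmatrix}$, and $\operatorname{Sp}(2n,\mathbb{R})$ is the group of real $2n\times2n$ matrices $S$ with $S^TJS=J$. $\operatorname{Sp}(2n,\vartheta)$ is the group of real $2n\times2n$ matrices $P$ with $\vartheta(Pz,Pz')=\vartheta(z,z')$ for all $z,z'\in\mathbb{R}^{2n}$; equivalently $P\Omega P^T=\Omega$. For a Hermitian matrix $H$, $H\ge0$ means positive semidefinite. *)

(* Defs.v *)
From HB Require Import structures.
From mathcomp Require Import all_boot all_order all_algebra.
From mathcomp Require Import classical_sets reals trigo.
From mathcomp Require Import complex.

Set Implicit Arguments.
Unset Strict Implicit.
Unset Printing Implicit Defensive.

Import Order.TTheory GRing.Theory Num.Theory.
Local Open Scope ring_scope.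
Local Open Scope complex_scope.
Local Open Scope sesquilinear_scope.

Definition Jmx (R : realType) (n : nat) : 'M[R]_(n + n) :=
  block_mx 0 1%:M (- 1%:M) 0.

Definition Sp (R : realType) (n : nat) : set 'M[R]_(n + n) :=
  [set S | S^T *m Jmx R n *m S = Jmx R n]%classic.

Definition D12 (R : realType) (n : nat) (S1 S2 : 'M[R]_(n + n)) :
    'M[R]_(n + n) :=
  block_mx (ulsubmx S1) (ursubmx S1) (ulsubmx S2) (ursubmx S2).

Definition Omega (R : realType) (n : nat) (S1 S2 : 'M[R]_(n + n)) :
    'M[R]_(n + n) :=
  D12 S1 S2 *m Jmx R n *m (D12 S1 S2)^T.

(* [invmx W] is the inverse of [W] only when [W \in unitmx]; for
   [W = Omega S1 S2] this amounts to [\det (D12 S1 S2) != 0]. *)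
Definition vartheta (R : realType) (m : nat) (W : 'M[R]_m) (z z' : 'cV[R]_m) :
    R :=
  (z^T *m (invmx W *m z')) 0 0.

Definition SpForm (R : realType) (m : nat) (f : 'cV[R]_m -> 'cV[R]_m -> R) :
    set 'M[R]_m :=
  [set P | forall z z' : 'cV[R]_m, f (P *m z) (P *m z') = f z z']%classic.

(* In the order of [R[i]], [0 <= x] says that [x] is real and nonnegative. *)
Definition psdmx (R : realType) (m : nat) (H : 'M[R[i]]_m) : Prop :=
  H \is hermsymmx /\ forall v : 'cV[R[i]]_m, 0 <= (v ^t* *m H *m v) 0 0.

Definition uncertainty (R : realType) (m : nat) (W U : 'M[R]_m) : Prop :=
  psdmx (map_mx (real_complex R) U +
         ('i%C / (4 * (pi : R)%:C)) *: map_mx (real_complex R) W).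

(* Main.v *)
Require Import Defs.
From mathcomp Require Import all_boot all_order all_algebra.
From mathcomp Require Import classical_sets reals trigo.
From mathcomp Require Import complex.

Import Order.TTheory GRing.Theory Num.Theory.
Local Open Scope ring_scope.

(** Invariance of the form [vartheta W] reads [P^T W^-1 P = W^-1], which for
    invertible [W] is the same as [P W P^T = W].  Hence replacing [U] by
    [P U P^T] amounts to replacing the Hermitian matrix
    [U + i/(4 pi) W] by its congruence under the real matrix [P], and
    congruences preserve positive semidefiniteness. *)

Lemma trmxC_mul (C : numClosedFieldType) (m n p : nat)
    (A : 'M[C]_(m, n)) (B : 'M[C]_(n, p)) :
  ((A *m B) ^t* = B ^t* *m A ^t*)%sesqui.
Proof. by rewrite trmx_mul map_mxM. Qed.

Lemma trmxC_real (R : rcfType) (m n : nat) (A : 'M[R]_(m, n)) :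
  ((map_mx (real_complex R) A) ^t* = map_mx (real_complex R) A^T)%sesqui.
Proof. by apply/matrixP => i j; rewrite !mxE; apply: conjc_real. Qed.

(** The quadratic form of the congruent matrix at [v] is that of [H] at [M ^t* *m v]. *)
Lemma psdmx_congr (R : realType) (m n : nat) (M : 'M[R[i]]_(m, n))
    (H : 'M[R[i]]_n) :
  psdmx H -> psdmx (M *m H *m (M ^t*)%sesqui).
Proof.
case=> /is_hermitianmxP; rewrite expr0 scale1r => hermH posH; split.
  apply/is_hermitianmxP.
  by rewrite expr0 scale1r !trmxC_mul trmxCK -hermH mulmxA.
move=> v; have := posH ((M ^t*)%sesqui *m v).
by rewrite trmxC_mul trmxCK !mulmxA.
Qed.

(** A real [P] has conjugate transpose [P^T], so the congruence distributes over the sum and acts on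
    [U] and [W] separately. *)
Lemma uncertainty_congr (R : realType) (m n : nat) (P : 'M[R]_(m, n))
    (W U : 'M[R]_n) :
  uncertainty W U -> uncertainty (P *m W *m P^T) (P *m U *m P^T).
Proof.
move=> /(@psdmx_congr R m n (map_mx (real_complex R) P)).
by rewrite trmxC_real mulmxDr mulmxDl -scalemxAr -scalemxAl -!map_mxM.
Qed.

(** Since [J] squares to [-1], its inverse is [-J]. *)
Lemma Jmx_unit (R : realType) (n : nat) : Jmx R n \in unitmx.
Proof.
have : Jmx R n *m (- Jmx R n) = 1%:M.
  rewrite mulmxN /Jmx mulmx_block !mul0mx !mulmx0 !mulmx1 !mul1mx.
  by rewrite !add0r !addr0 opp_block_mx !opprK !oppr0 -scalar_mx_block.
by case/mulmx1_unit.
Qed.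

Lemma Omega_unit (R : realType) (n : nat) (S1 S2 : 'M[R]_(n + n)) :
  \det (D12 S1 S2) != 0 -> Omega S1 S2 \in unitmx.
Proof.
move=> hD; rewrite /Omega !unitmx_mul unitmx_tr Jmx_unit andbT.
by rewrite unitmxE unitfE hD.
Qed.

(** Evaluating the forms at basis vectors reads off the matrix entries. *)
Lemma mx_bilinear_inj (R : pzRingType) (m n : nat) (A B : 'M[R]_(m, n)) :
  (forall (u : 'cV[R]_m) (v : 'cV[R]_n),
     (u^T *m (A *m v)) 0 0 = (u^T *m (B *m v)) 0 0) -> A = B.
Proof.
move=> eqAB; apply/matrixP => i j.
have := eqAB (delta_mx i 0) (delta_mx j 0).
by rewrite !trmx_delta -!rowE -!colE !mxE.
Qed.

Lemma SpForm_vartheta (R : realType) (m : nat) (W P : 'M[R]_m) :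
  W \in unitmx -> SpForm (vartheta W) P -> P *m W *m P^T = W.
Proof.
move=> Wu hP.
have PWP : P^T *m invmx W *m P = invmx W.
  apply: mx_bilinear_inj => u v; have := hP u v; rewrite /vartheta => <-.
  by rewrite trmx_mul !mulmxA.
(* A one-sided inverse of a square matrix is two-sided, so the factors may be swapped:
   [P W P^T W^-1 = 1]. Multiplying by [W] on the right then gives the claim. *)
have /mulmx1C PW1 : P^T *m invmx W *m (P *m W) = 1%:M.
  by rewrite mulmxA PWP mulVmx.
by rewrite -[LHS](mulmxKV Wu) -(mulmxA _ P^T) PW1 mul1mx.
Qed.

Theorem proposition9 (R : realType) (n : nat) (S1 S2 : 'M[R]_(n + n))
    (hS1 : Sp S1) (hS2 : Sp S2)
    (hD : \det (D12 S1 S2) != 0)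
    (P : 'M[R]_(n + n)) (hP : SpForm (vartheta (Omega S1 S2)) P)
    (U : 'M[R]_(n + n)) (hUsym : U^T = U)
    (hU : uncertainty (Omega S1 S2) U) :
  uncertainty (Omega S1 S2) (P *m U *m P^T).
Proof.
(* Writing [Omega] as [P Omega P^T] turns the goal into a congruence of [hU]. *)
rewrite -[Omega S1 S2](SpForm_vartheta _ _ _ _ (Omega_unit _ _ _ _ hD) hP).
exact: uncertainty_congr.
Qed.
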